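(* Let $N\ge1$ be an integer and let $\alpha,\beta$ be real parameters with $|a_n|<1$ for all $n\ge 0$. Let $$H(N)=L(N)^2-N(\alpha+\beta+1)L(N),\qquad \tilde H(N)=\phi(z)^{-1}H(N)\,\phi(z),\qquad \phi(z)=z-z^{-1},$$ where $\phi(z)^{\pm1}$ denote multiplication operators. Then the sieved Jacobi polynomials of the first kind $P_n(x(z);N)$ and of the second kind $Q_n(x(z);N)$, with $x(z)=z+z^{-1}$, satisfy for all $n\ge 0$ the eigenvalue equations $$H(N)P_n(x(z);N)=\Lambda_n(N)P_n(x(z);N),\qquad \tilde H(N)Q_n(x(z);N)=\Lambda_{n+1}(N)Q_n(x(z);N),$$ where $\Lambda_n(N)=n\bigl(n+N(\alpha+\beta+1)\bigr)$.
   Context: Given real $\alpha,\beta$, put $$a_n=-\frac{\alpha+\frac12+(-1)^{n+1}(\beta+\frac12)}{n+\alpha+\beta+2},\qquad n=0,1,2,\dots,$$ and assume $|a_n|<1$ for all $n\ge0$ (equivalently $\alpha,\beta>-1$). The sieved Verblunsky parameters are, for $n\ge 0$, $a_n(N)=a_{k-1}$ if $n=Nk-1$ for an integer $k\ge1$, and $a_n(N)=0$ otherwise. The sieved Jacobi orthogonal polynomials on the unit circle $\Phi_n(z;N)$ are the monic polynomials defined by $\Phi_0(z;N)=1$ and $$\Phi_{n+1}(z;N)=z\,\Phi_n(z;N)-a_n(N)\,z^n\Phi_n(z^{-1};N),\qquad n\ge 0.$$ The associated CMV Laurent polynomials are $\psi_{2n}(z;N)=z^n\Phi_{2n}(z^{-1};N)$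 and $\psi_{2n+1}(z;N)=z^{-n}\Phi_{2n+1}(z;N)$, $n\ge0$. The sieved Jacobi polynomials on the real line of the first kind $P_n(x;N)$ and second kind $Q_n(x;N)$ are the monic polynomials of degree $n$ in $x=x(z)=z+z^{-1}$ given by $P_0=1$ and, for $n\ge1$, $$P_n(x(z);N)=\psi_{2n}(z;N)+(1+a_{2n-1}(N))\,\psi_{2n-1}(z;N),$$ $$(z-z^{-1})\,Q_{n-1}(x(z);N)=-\psi_{2n}(z;N)+(1-a_{2n-1}(N))\,\psi_{2n-1}(z;N).$$ With $q=e^{2\pi i/N}$, $R_kf(z)=f(q^k/z)$ and $\mathcal I$ the identity, $$L(N)=z\partial_z+\sum_{k=0}^{N-1}A_k(z;N)(R_k-\mathcal I),$$ where for $N$ even $A_k(z;N)=\sigma_k\frac{z^2}{q^k-z^2}$ with $\sigma_k=\alpha+\beta+1+(-1)^k(\alpha-\beta)$, and for $N$ odd $A_k(z;N)=\frac{(\alpha+\beta+1)z^2+\rho_k(\alpha-\beta)z}{q^k-z^2}$ with $\rho_k=q^{k/2}$ for $k$ even and $\rho_k=q^{(k-N)/2}$ for $k$ odd. Identities are understood as identities of rational functions of $z$. *)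

(* Defs.v *)
From HB Require Import structures.
From mathcomp Require Export all_boot all_order all_algebra.
From mathcomp Require Import generic_quotient.
From mathcomp Require Export reals trigo.
From mathcomp.real_closed Require Export complex.
From mathcomp Require Import ring lra zify.

Set Implicit Arguments.
Unset Strict Implicit.
Unset Printing Implicit Defensive.

Import Order.TTheory GRing.Theory Num.Theory.
Local Open Scope complex_scope.
Local Open Scope quotient_scope.
Local Open Scope ring_scope.

Notation "x %:F" := (FracField.tofrac x) (format "x %:F") : ring_scope.

Notation ratfun R := {fraction {poly R[i]}}.

Section RationalFunctions.
Variable R : realType.
Local Notation K := (ratfun R).

Definition cst : R[i] -> K := @FracField.tofrac {poly R[i]} \o polyC.
HB.instance Definition _ := GRing.RMorphism.copy cst
  (@FracField.tofrac {poly R[i]} \o polyC).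

Definition rcst (r : R) : K := cst r%:C.

Definition zvar : K := 'X%:F.

(* Value in K at g of a polynomial with coefficients in R[i]. *)
Definition peval (g : K) (p : {poly R[i]}) : K := (map_poly cst p).[g].

(* f(g(z)), computed on a representative n/d of f. The result is independent
   of the representative as soon as g is transcendental, see subst_frac; only
   g = c / z with c != 0 is used below, see peval_inv_neq0. *)
Definition substf (g f : K) : K := peval g \n_(repr f) / peval g \d_(repr f).

(* Quotient rule on a representative; see ratderiv_frac for independence. *)
Definition ratderiv (f : K) : K :=
  let n := \n_(repr f) in let d := \d_(repr f) in
  (n^`() * d - n * d^`())%:F / (d ^+ 2)%:F.

Lemma repr_frac (f : K) : f = (\n_(repr f))%:F / (\d_(repr f))%:F.
Proof.
have d0 := denom_ratioP (repr f).
have dF0 : (\d_(repr f))%:F != 0 :> K by rewrite tofrac_eq0.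
apply: (mulIf dF0); rewrite mulfVK //.
rewrite -{1}[f]reprK -[repr f]Ratio_numden.
move: d0; set n := \n_ _; set d := \d_ _ => d0.
rewrite !piE; apply/eqmodP => /=.
rewrite FracField.equivfE /FracField.mulf !numden_Ratio ?mulf_neq0 ?oner_eq0 //.
by rewrite !mulr1 mulrC.
Qed.

Lemma frac_cross (p d n e : {poly R[i]}) : d != 0 -> e != 0 ->
  p%:F / d%:F = n%:F / e%:F :> K -> p * e = n * d.
Proof.
move=> d0 e0 E; apply/eqP; rewrite -tofrac_eq !tofracM.
by rewrite -eqr_div ?tofrac_eq0 // E.
Qed.

Lemma subst_frac (g : K) (p d : {poly R[i]}) :
  (forall r, r != 0 -> peval g r != 0) -> d != 0 ->
  substf g (p%:F / d%:F) = peval g p / peval g d.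
Proof.
move=> gtr d0; rewrite /substf; set f := p%:F / d%:F.
have e0 := denom_ratioP (repr f).
have := frac_cross d0 e0 (repr_frac f) => E.
apply/eqP; rewrite eqr_div ?gtr //; apply/eqP.
by rewrite /peval -!hornerM -!rmorphM /= -E.
Qed.

Lemma ratderiv_frac (p d : {poly R[i]}) : d != 0 ->
  ratderiv (p%:F / d%:F) = (p^`() * d - p * d^`())%:F / (d ^+ 2)%:F.
Proof.
move=> d0; rewrite /ratderiv; set f := p%:F / d%:F.
have e0 := denom_ratioP (repr f).
have := frac_cross d0 e0 (repr_frac f).
move: e0; set n := \n_ _; set e := \d_ _ => e0 E.
have E' : p^`() * e + p * e^`() = n^`() * d + n * d^`() by rewrite -!derivM E.
apply/eqP; rewrite eqr_div ?tofrac_eq0 ?expf_neq0 // -!tofracM tofrac_eq.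
apply/eqP.
have -> : (n^`() * e - n * e^`()) * d ^+ 2 =
   d * (e * (n^`() * d + n * d^`()) - n * d * e^`() - e * n * d^`()) by ring.
rewrite -E' -E; apply/eqP; rewrite -subr_eq0; apply/eqP.
transitivity (d^`() * e * (p * e - n * d)); first by ring.
by rewrite E subrr mulr0.
Qed.

Lemma zvar_neq0 : zvar != 0. Proof. by rewrite tofrac_eq0 polyX_eq0. Qed.

Lemma cst_eq0 c : (cst c == 0) = (c == 0).
Proof. by rewrite /cst /= tofrac_eq0 polyC_eq0. Qed.

Definition revp (m : nat) (p : {poly R[i]}) : {poly R[i]} :=
  \poly_(i < m.+1) p`_(m - i).

Lemma peval_sum g m (p : {poly R[i]}) : (size p <= m)%N ->
  peval g p = \sum_(i < m) cst p`_i * g ^+ i.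
Proof.
move=> sp; rewrite /peval (@horner_coef_wide _ m) ?size_map_poly //.
by apply: eq_bigr => i _; rewrite coef_map.
Qed.

Lemma tofrac_sum m (p : {poly R[i]}) : (size p <= m)%N ->
  p%:F = \sum_(i < m) cst p`_i * zvar ^+ i :> K.
Proof.
move=> sp; have {1}-> : p = \poly_(i < m) p`_i.
  apply/polyP => i; rewrite coef_poly; case: ltnP => // h.
  by rewrite nth_default // (leq_trans sp).
rewrite poly_def raddf_sum; apply: eq_bigr => i _.
by rewrite -mul_polyC /= tofracM tofracXn.
Qed.

Lemma peval_inv m (p : {poly R[i]}) : (size p <= m.+1)%N ->
  zvar ^+ m * peval zvar^-1 p = (revp m p)%:F.
Proof.
move=> sp; rewrite (peval_sum _ sp) (@tofrac_sum m.+1) ?size_poly //.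
rewrite [RHS](reindex_inj rev_ord_inj) mulr_sumr; apply: eq_bigr => i _ /=.
have im : (i <= m)%N by rewrite -ltnS.
rewrite coef_poly subSS ltnS leq_subr subKn // mulrCA; congr (_ * _).
rewrite exprVn; have -> : zvar ^+ m = zvar ^+ (m - i) * zvar ^+ i.
  by rewrite -exprD subnK.
by rewrite mulfK // expf_neq0 // zvar_neq0.
Qed.

Lemma peval_inv_neq0 (c : R[i]) (p : {poly R[i]}) :
  c != 0 -> p != 0 -> peval (cst c / zvar) p != 0.
Proof.
move=> c0 p0; have -> : peval (cst c / zvar) p =
    peval zvar^-1 (p \Po (c *: 'X)).
  rewrite /peval map_comp_poly horner_comp /= map_polyZ /= map_polyX.
  by rewrite hornerZ hornerX.
set r := p \Po _.
have r0 : r != 0.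
  apply: contraNneq p0 => r0; have := congr1 (fun s => s \Po (c^-1 *: 'X)) r0.
  rewrite comp_poly0 /r -comp_polyA comp_polyZ comp_polyX scalerA divff //.
  by rewrite scale1r comp_polyXr => ->.
have sr : (size r <= (size r).-1.+1)%N by rewrite leqSpred.
suff: zvar ^+ (size r).-1 * peval zvar^-1 r != 0.
  by apply: contraNneq => ->; rewrite mulr0.
rewrite (peval_inv sr) tofrac_eq0; apply/eqP => /polyP /(_ 0%N) /eqP.
by rewrite coef_poly subn0 coef0 -lead_coefE lead_coef_eq0 (negbTE r0).
Qed.

Lemma subst_inv_frac (c : R[i]) (p d : {poly R[i]}) : c != 0 -> d != 0 ->
  substf (cst c / zvar) (p%:F / d%:F) =
  peval (cst c / zvar) p / peval (cst c / zvar) d.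
Proof. by move=> c0 d0; apply: subst_frac => // r; exact: peval_inv_neq0. Qed.

Lemma subst_invz (p : {poly R[i]}) : substf zvar^-1 p%:F = peval zvar^-1 p.
Proof.
have z1 : zvar^-1 = cst 1 / zvar by rewrite rmorph1 mul1r.
rewrite -[p%:F]divr1 -tofrac1 z1 subst_inv_frac ?oner_neq0 //.
have pe1 g : peval g 1 = 1 :> K by rewrite /peval rmorph1 hornerC.
by rewrite pe1 divr1.
Qed.

End RationalFunctions.

Arguments zvar {R}.

Section SievedJacobi.
Variables (R : realType) (alpha beta : R) (N : nat).
Local Notation K := (ratfun R).

Definition jacobi_a (n : nat) : R :=
  - (alpha + 2^-1 + (-1) ^+ n.+1 * (beta + 2^-1)) / (n%:R + alpha + beta + 2).

Definition sieved_a (n : nat) : R :=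
  if (N %| n.+1)%N then jacobi_a (n.+1 %/ N).-1 else 0.

Fixpoint Phi (n : nat) : K :=
  if n is m.+1 then
    zvar * Phi m - rcst (sieved_a m) * (zvar ^+ m * substf zvar^-1 (Phi m))
  else 1.

Definition psi (m : nat) : K :=
  if odd m then zvar ^- m./2 * Phi m
  else zvar ^+ m./2 * substf zvar^-1 (Phi m).

Definition at_x (p : {poly R[i]}) : K := peval (zvar + zvar^-1) p.

Definition is_first_kind (P : nat -> {poly R[i]}) : Prop :=
  [/\ forall n, P n \is monic /\ size (P n) = n.+1,
      P 0%N = 1
    & forall n, (1 <= n)%N ->
        at_x (P n) = psi (2 * n)
                     + (1 + rcst (sieved_a (2 * n - 1))) * psi (2 * n - 1)].

Definition is_second_kind (Q : nat -> {poly R[i]}) : Prop :=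
  (forall n, Q n \is monic /\ size (Q n) = n.+1) /\
  (forall n, (1 <= n)%N ->
     (zvar - zvar^-1) * at_x (Q n.-1) =
       - psi (2 * n)
       + (1 - rcst (sieved_a (2 * n - 1))) * psi (2 * n - 1)).

(* exp (2 pi i / N) *)
Definition qroot : R[i] := cos (2 * pi / N%:R) +i* sin (2 * pi / N%:R).

Definition Refl (k : nat) (f : K) : K := substf (cst (qroot ^+ k) / zvar) f.

Definition sigma (k : nat) : R :=
  alpha + beta + 1 + (-1) ^+ k * (alpha - beta).

(* Used only for N odd and k < N: all the halves are exact, and qroot ^- m is
   qroot ^ (- m). *)
Definition rho (k : nat) : R[i] :=
  if odd k then qroot ^- (N - k)./2 else qroot ^+ k./2.

Definition Acoef (k : nat) : K :=
  if odd N then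
    (rcst (alpha + beta + 1) * zvar ^+ 2
     + cst (rho k) * rcst (alpha - beta) * zvar) / (cst (qroot ^+ k) - zvar ^+ 2)
  else rcst (sigma k) * (zvar ^+ 2 / (cst (qroot ^+ k) - zvar ^+ 2)).

Definition Lop (f : K) : K :=
  zvar * ratderiv f + \sum_(k < N) Acoef k * (Refl k f - f).

Definition Hop (f : K) : K :=
  Lop (Lop f) - rcst (N%:R * (alpha + beta + 1)) * Lop f.

Definition Htilde (f : K) : K :=
  (zvar - zvar^-1)^-1 * Hop ((zvar - zvar^-1) * f).

Definition Lambda (n : nat) : R :=
  n%:R * (n%:R + N%:R * (alpha + beta + 1)).

(* The convention x / 0 = 0 plays no role in jacobi_a. *)
Lemma jacobi_den_gt0 : (forall n, `|jacobi_a n| < 1) ->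
  forall n : nat, 0 < n%:R + alpha + beta + 2.
Proof.
move=> H; suff s0 : 0 < alpha + beta + 2.
  by move=> n; have := ler0n R n; lra.
have key n : odd n -> n%:R + alpha + beta + 2 != 0 ->
    (alpha + beta + 1) ^+ 2 < (n%:R + alpha + beta + 2) ^+ 2.
  move=> on d0; have := H n; rewrite /jacobi_a normrM normfV normrN.
  rewrite ltr_pdivrMr ?normr_gt0 // mul1r -signr_odd /= on expr0 mul1r => lt.
  move: lt; have -> : alpha + 2^-1 + (beta + 2^-1) = alpha + beta + 1 by lra.
  by rewrite -ltr_sqr ?nnegrE // !real_normK ?num_real.
have [e1|n1] := eqVneq (1%:R + alpha + beta + 2) 0.
  have := key 3%N isT; have e3 : alpha + beta = -3 by lra.
  have -> : 3%:R + alpha + beta + 2 = 2 by lra.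
  have -> : alpha + beta + 1 = - 2 by lra.
  by rewrite sqrrN ltxx => k3; have : false by apply: k3; rewrite pnatr_eq0.
by have := key 1%N isT n1; nra.
Qed.

(* The remaining lemmas lead to exists_first_kind and exists_second_kind: the
   predicates above are satisfiable for all alpha, beta, N. *)

Fixpoint Phipoly (n : nat) : {poly R[i]} :=
  if n is m.+1 then
    'X * Phipoly m - (sieved_a m)%:C%:P * revp m (Phipoly m)
  else 1.

Lemma size_revp m (p : {poly R[i]}) : (size (revp m p) <= m.+1)%N.
Proof. exact: size_poly. Qed.

Lemma Phipoly_monic n : Phipoly n \is monic /\ size (Phipoly n) = n.+1.
Proof.
elim: n => [|n [mo sz]] /=; first by rewrite monic1 size_poly1.
have sX : size ('X * Phipoly n) = n.+2.
  by rewrite mulrC size_mulX ?sz // monic_neq0.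
have lt : leq (size (- ((sieved_a n)%:C%:P * revp n (Phipoly n)))).+1
              (size ('X * Phipoly n)).
  rewrite size_polyN sX ltnS mul_polyC.
  exact: leq_trans (size_scale_leq _ _) (size_revp _ _).
split; last by rewrite size_polyDl.
by rewrite monicE lead_coefDl // lead_coefM lead_coefX mul1r.
Qed.

Lemma PhiE n : Phi n = (Phipoly n)%:F.
Proof.
elim: n => [|n IH] /=; first by rewrite tofrac1.
rewrite IH subst_invz peval_inv ?(Phipoly_monic n).2 //.
by rewrite tofracB !tofracM.
Qed.

Lemma psiE_even n : psi (2 * n.+1) = zvar ^- n.+1 *
  (revp n.*2.+1 (Phipoly n.*2.+1)
   - (sieved_a n.*2.+1)%:C%:P * ('X * Phipoly n.*2.+1))%:F.
Proof.
rewrite /psi mul2n odd_double doubleK PhiE subst_invz.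
have sz := (Phipoly_monic n.+1.*2).2.
apply: (mulfI (expf_neq0 n.+1 (zvar_neq0 R))).
rewrite mulrA -exprD addnn peval_inv ?sz // mulVKf ?expf_neq0 ?zvar_neq0 //.
congr (_ %:F); rewrite doubleS /=; apply/polyP => i.
have s1 := (Phipoly_monic n.*2.+1).2.
set f := 'X * Phipoly n.*2 - _.
rewrite -[f]/(Phipoly n.*2.+1); set g := Phipoly n.*2.+1 in s1 *.
rewrite coef_poly !coefB !coefXM !mul_polyC !coefZ coefXM !coef_poly.
case: (ltnP i n.*2.+3) => li.
  case: i li => [|i] li /=.
    by rewrite !subn0 ltnn !mulr0.
  have -> : (n.*2.+2 - i.+1 = n.*2.+1 - i)%N by lia.
  have -> : (n.*2.+1 - i < n.*2.+2)%N by lia.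
  case: (ltnP i n.*2.+1) => h.
    have -> : (n.*2.+1 - i == 0)%N = false by lia.
    rewrite ltnS h; congr (g`_ _ - _ * g`_ _); lia.
  have -> : (i = n.*2.+1)%N by lia.
  by rewrite subnn ltnn subn0.
have -> : (i == 0)%N = false by lia.
have -> : (i < n.*2.+2)%N = false by lia.
by rewrite nth_default ?mulr0 ?subr0 // s1; lia.
Qed.

Lemma psiE_odd n : psi (2 * n.+1 - 1) = zvar ^- n.+1 *
  ('X * Phipoly n.*2.+1)%:F.
Proof.
have -> : (2 * n.+1 - 1 = n.*2.+1)%N by lia.
have h2 : (n.*2.+1./2 = n)%N by lia.
rewrite /psi oddS odd_double h2 PhiE [in RHS]tofracM mulrA; congr (_ * _).
by rewrite -/(@zvar R) exprSr invfM -mulrA mulVf ?zvar_neq0 // mulr1.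
Qed.

Lemma sum_psi_first n :
  psi (2 * n.+1) + (1 + rcst (sieved_a (2 * n.+1 - 1))) * psi (2 * n.+1 - 1) =
  zvar ^- n.+1 *
    ('X * Phipoly n.*2.+1 + revp n.*2.+1 (Phipoly n.*2.+1))%:F.
Proof.
rewrite psiE_even psiE_odd; have -> : (2 * n.+1 - 1 = n.*2.+1)%N by lia.
rewrite !(tofracD, tofracB, tofracN, tofracM) -[_%:P%:F]/(rcst _).
move: (rcst _) (zvar ^- _) (_%:F) (_%:F) (_%:F) => a w f g x; ring.
Qed.

Lemma sum_psi_second n :
  - psi (2 * n.+1) + (1 - rcst (sieved_a (2 * n.+1 - 1))) * psi (2 * n.+1 - 1) =
  zvar ^- n.+1 *
    ('X * Phipoly n.*2.+1 - revp n.*2.+1 (Phipoly n.*2.+1))%:F.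
Proof.
rewrite psiE_even psiE_odd; have -> : (2 * n.+1 - 1 = n.*2.+1)%N by lia.
rewrite !(tofracD, tofracB, tofracN, tofracM) -[_%:P%:F]/(rcst _).
move: (rcst _) (zvar ^- _) (_%:F) (_%:F) (_%:F) => a w f g x; ring.
Qed.

Lemma at_xD p r : at_x (p + r) = at_x p + at_x r.
Proof. by rewrite /at_x /peval rmorphD hornerD. Qed.

Lemma at_xZXn c n : at_x (c *: 'X^n) = cst c * (zvar + zvar^-1) ^+ n.
Proof. by rewrite /at_x /peval map_polyZ /= map_polyXn hornerZ hornerXn. Qed.

Lemma coef_rev_sym (e : R[i]) m (W : {poly R[i]}) i :
  revp m W = e *: W -> (i <= m)%N -> W`_(m - i) = e * W`_i.
Proof.
by move=> /polyP /(_ i); rewrite coef_poly coefZ ltnS => E le; rewrite le in E.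
Qed.

Lemma rev_eqP (e : R[i]) m (W : {poly R[i]}) : (size W <= m.+1)%N ->
  (forall i, (i <= m)%N -> W`_(m - i) = e * W`_i) -> revp m W = e *: W.
Proof.
move=> sW H; apply/polyP => i; rewrite coef_poly coefZ ltnS.
case: leqP => [/H //|lt]; rewrite nth_default ?mulr0 //.
exact: leq_trans sW lt.
Qed.

Lemma rev_lin c m (p r : {poly R[i]}) :
  revp m (p - c *: r) = revp m p - c *: revp m r.
Proof.
apply/polyP => i; rewrite coefB coefZ !coef_poly coefB coefZ.
by case: ifP => _ //; rewrite mulr0 subr0.
Qed.

Lemma tofrac_inj2 (p r : {poly R[i]}) : p%:F = r%:F :> K -> p = r.
Proof. by move/eqP; rewrite tofrac_eq => /eqP. Qed.

Lemma size_X21 n : (size (('X^2 + 1) ^+ n : {poly R[i]}) <= n.*2.+1)%N.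
Proof.
apply: leq_trans (size_poly_exp_leq _ n) _.
by rewrite -polyC1 size_XnaddC //= mul2n.
Qed.

Lemma coef_X21 n : (('X^2 + 1) ^+ n : {poly R[i]})`_(n.*2) = 1.
Proof.
have mo : ('X^2 + 1 : {poly R[i]}) \is monic.
  by rewrite -polyC1 monicXnaddC.
have := monic_exp n mo; rewrite monicE lead_coefE size_exp -polyC1.
by rewrite size_XnaddC //= mul2n => /eqP.
Qed.

Lemma size_X22 n :
  (size (('X^2 - 1) * ('X^2 + 1) ^+ n : {poly R[i]})%R <= n.+1.*2.+1)%N.
Proof.
apply: leq_trans (size_polyMleq _ _) _; rewrite -{1}polyC1 size_XnsubC //=.
by rewrite doubleS !ltnS; exact: size_X21.
Qed.

Lemma peval_invM (p r : {poly R[i]}) :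
  peval zvar^-1 (p * r) = peval zvar^-1 p * peval zvar^-1 r.
Proof. by rewrite /peval rmorphM hornerM. Qed.

Lemma rev_X21 n : revp n.*2 (('X^2 + 1) ^+ n) = ('X^2 + 1) ^+ n :> {poly R[i]}.
Proof.
apply: tofrac_inj2; rewrite -peval_inv ?size_X21 //.
rewrite /peval !rmorphXn /= rmorphD /= map_polyXn rmorph1 horner_exp.
rewrite hornerD hornerXn hornerC -mul2n exprM -exprMn; congr (_ ^+ _).
rewrite tofracD tofracXn tofrac1 -/(@zvar R) mulrDr mulr1 exprVn.
by rewrite mulfV ?expf_neq0 ?zvar_neq0 // addrC.
Qed.

Lemma rev_X22 n :
  revp n.+1.*2 (('X^2 - 1) * ('X^2 + 1) ^+ n) =
  - (('X^2 - 1) * ('X^2 + 1) ^+ n) :> {poly R[i]}.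
Proof.
apply: tofrac_inj2; rewrite -peval_inv; last exact: size_X22.
rewrite peval_invM doubleS -addn2 addnC exprD mulrACA.
rewrite [X in _ * X]peval_inv ?size_X21 // rev_X21 tofracN tofracM -mulNr.
congr (_ * _).
rewrite /peval rmorphB /= map_polyXn rmorph1 hornerD hornerXn hornerN hornerC.
rewrite tofracB tofracXn tofrac1 -/(@zvar R) mulrBr mulr1 exprVn.
by rewrite mulfV ?expf_neq0 ?zvar_neq0 // opprB.
Qed.

(* Removing the extreme coefficients of a (skew-)palindromic polynomial. *)
Lemma peel (e : R[i]) n (W : {poly R[i]}) : (size W <= n.+1.*2.+1)%N ->
  revp n.+1.*2 W = e *: W -> W`_(n.+1.*2) = 0 -> 
  exists2 V : {poly R[i]}, W = 'X * V &
    (size V <= n.*2.+1)%N /\ revp n.*2 V = e *: V.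
Proof.
move=> sW sym top.
have W0 : W`_0 = 0.
  by have := coef_rev_sym sym (leqnn _); rewrite subnn top mulr0.
have sW' : (size W <= n.*2.+2)%N.
  apply/leq_sizeP => j; rewrite leq_eqVlt => /orP[/eqP <-|lt].
    by rewrite -doubleS.
  by move/leq_sizeP: sW => -> //; lia.
exists (\poly_(i < n.*2.+1) W`_i.+1).
  apply/polyP => -[|i]; rewrite coefXM //= coef_poly.
  case: ltnP => // h; apply: nth_default; exact: leq_trans sW' _.
split; first exact: size_poly.
apply: rev_eqP; first exact: size_poly.
move=> i le; rewrite !coef_poly !ltnS leq_subr le.
rewrite -(coef_rev_sym sym) //; last by lia.
by congr (W`_ _); lia.
Qed.

Lemma zX21 : ('X^2 + 1)%:F = zvar * (zvar + zvar^-1) :> K.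
Proof.
by rewrite mulrDr mulfV ?zvar_neq0 // tofracD tofracXn tofrac1 expr2.
Qed.

Lemma zX22 : ('X^2 - 1)%:F = zvar * (zvar - zvar^-1) :> K.
Proof.
by rewrite mulrBr mulfV ?zvar_neq0 // tofracB tofracXn tofrac1 expr2.
Qed.

Lemma sym_at_x n (W : {poly R[i]}) : (size W <= n.*2.+1)%N -> revp n.*2 W = W ->
  exists2 p : {poly R[i]}, at_x p = zvar ^- n * W%:F &
    (size p <= n.+1)%N /\ p`_n = W`_(n.*2).
Proof.
elim: n W => [|n IH] W sW sym.
  exists W => //; rewrite expr0 invr1 mul1r (size1_polyC sW) /at_x /peval.
  by rewrite map_polyC hornerC.
pose c := W`_(n.+1.*2); pose T : {poly R[i]} := ('X^2 + 1) ^+ n.+1.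
have sWT : (size (W - c *: T)%R <= n.+1.*2.+1)%N.
  rewrite (leq_trans (size_polyD _ _)) // geq_max sW size_polyN.
  exact: leq_trans (size_scale_leq _ _) (size_X21 _).
have [||V EV [sV symV]] := @peel 1 n _ sWT.
- by rewrite rev_lin sym rev_X21 scale1r.
- by rewrite coefB coefZ coef_X21 mulr1 subrr.
rewrite scale1r in symV; have [p Ep [sp _]] := IH V sV symV.
exists (c *: 'X^(n.+1) + p).
  rewrite at_xD at_xZXn Ep.
  have -> : W = c *: T + 'X * V by rewrite -EV addrC subrK.
  rewrite tofracD mulrDr -mul_polyC !tofracM -/(cst c) -/(@zvar R); congr (_ + _).
    rewrite mulrCA; congr (_ * _).
    by rewrite /T tofracXn zX21 exprMn mulKf // expf_neq0 ?zvar_neq0.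
  by rewrite exprSr invfM -mulrA mulKf ?zvar_neq0.
split.
  rewrite (leq_trans (size_polyD _ _)) // geq_max (leqW sp) andbT.
  by rewrite (leq_trans (size_scale_leq _ _)) // size_polyXn.
by rewrite coefD coefZ coefXn eqxx mulr1 [p`__]nth_default ?addr0.
Qed.

Lemma skew_at_x n (W : {poly R[i]}) : (size W <= n.*2.+1)%N ->
  revp n.*2 W = -1 *: W ->
  exists2 p : {poly R[i]},
    (zvar - zvar^-1) * at_x p = zvar ^- n * W%:F &
    (size p <= n)%N /\ ((0 < n)%N -> p`_n.-1 = W`_(n.*2)).
Proof.
elim: n W => [|n IH] W sW sym.
  have W0 : W`_0 = 0.
    have := coef_rev_sym sym (leqnn _); rewrite subnn mulN1r => /eqP.
    by rewrite -subr_eq0 opprK -mulr2n mulrn_eq0 /= => /eqP.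
  exists 0; last by rewrite size_poly0.
  rewrite (size1_polyC sW) W0 tofrac0 mulr0 /at_x /peval.
  by rewrite map_poly0 horner0 mulr0.
pose c := W`_(n.+1.*2).
pose T : {poly R[i]} := ('X^2 - 1) * ('X^2 + 1) ^+ n.
have sT : (size T <= n.+1.*2.+1)%N by exact: size_X22.
have cT : T`_(n.+1.*2) = 1.
  rewrite /T mulrBl mul1r coefB coefXnM doubleS /= subSS subn1 coef_X21.
  by rewrite nth_default ?subr0 // (leq_trans (size_X21 n)).
have sWT : (size (W - c *: T)%R <= n.+1.*2.+1)%N.
  rewrite (leq_trans (size_polyD _ _)) // geq_max sW size_polyN.
  exact: leq_trans (size_scale_leq _ _) sT.
have [||V EV [sV symV]] := @peel (-1) n _ sWT.
- by rewrite rev_lin sym rev_X22 scalerBr !scaleN1r scalerN.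
- by rewrite coefB coefZ cT mulr1 subrr.
have [p Ep [sp _]] := IH V sV symV.
exists (c *: 'X^n + p).
  rewrite at_xD at_xZXn mulrDr Ep.
  have -> : W = c *: T + 'X * V by rewrite -EV addrC subrK.
  rewrite tofracD mulrDr -mul_polyC !tofracM -/(cst c) -/(@zvar R); congr (_ + _).
    rewrite [LHS]mulrCA [RHS]mulrCA; congr (_ * _).
    rewrite tofracXn zX21 zX22 exprMn mulrACA -exprS.
    by rewrite mulKf // expf_neq0 ?zvar_neq0.
  by rewrite exprSr invfM -mulrA mulKf ?zvar_neq0.
split=> [|_ /=].
  rewrite (leq_trans (size_polyD _ _)) // geq_max (leqW sp) andbT.
  by rewrite (leq_trans (size_scale_leq _ _)) // size_polyXn.
by rewrite coefD coefZ coefXn eqxx mulr1 [p`__]nth_default ?addr0.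
Qed.

Lemma monic_size n (p : {poly R[i]}) : (size p <= n.+1)%N -> p`_n = 1 ->
  p \is monic /\ size p = n.+1.
Proof.
move=> sp c1; have E : size p = n.+1.
  apply/eqP; rewrite eqn_leq sp /= ltnNge; apply/negP => /leq_sizeP /(_ n).
  by rewrite c1 => /(_ (leqnn _)) /eqP; rewrite oner_eq0.
by split=> //; rewrite monicE lead_coefE E c1.
Qed.

Lemma Wcoef (e : R[i]) n :
  let W := 'X * Phipoly n.*2.+1 + e *: revp n.*2.+1 (Phipoly n.*2.+1) in
  [/\ (size W <= n.+1.*2.+1)%N, W`_(n.+1.*2) = 1 &
      e * e = 1 -> revp n.+1.*2 W = e *: W].
Proof.
move=> W; have [mo sz] := Phipoly_monic n.*2.+1.
have c1 : (Phipoly n.*2.+1)`_n.*2.+1 = 1.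
  by move: mo; rewrite monicE lead_coefE sz => /eqP.
have sW : (size W <= n.+1.*2.+1)%N.
  rewrite (leq_trans (size_polyD _ _)) // geq_max; apply/andP; split.
    by rewrite mulrC size_mulX ?monic_neq0 // sz.
  rewrite (leq_trans (size_scale_leq _ _)) //.
  by rewrite (leq_trans (size_revp _ _)) //; lia.
have top : W`_(n.+1.*2) = 1.
  by rewrite coefD coefXM coefZ coef_poly doubleS /= ltnn mulr0 addr0.
split=> // ee; apply: rev_eqP => // i le.
rewrite /W !coefD !coefXM !coefZ !coef_poly mulrDr mulrA ee mul1r addrC.
move: sz le; set f := Phipoly _ => sz le.
congr (_ + _).
  case: ltnP => h; last first.
    by have -> : (i == 0)%N by lia.
  have -> : (i == 0)%N = false by lia.
  by congr (_ * f`_ _); lia.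
case: (ltnP i n.*2.+2) => h.
  have -> : (n.+1.*2 - i == 0)%N = false by lia.
  by congr (f`_ _); lia.
by have -> : (n.+1.*2 - i == 0)%N by lia.
Qed.

Lemma exists_first_kind : exists P, is_first_kind P.
Proof.
suff H n : exists p : {poly R[i]}, [/\ p \is monic, size p = n.+1,
   (n == 0)%N ==> (p == 1) & (1 <= n)%N -> at_x p = psi (2 * n)
      + (1 + rcst (sieved_a (2 * n - 1))) * psi (2 * n - 1)].
  have [P HP] := boolp.choice H; exists P; split=> [n||n n1].
  - by have [] := HP n.
  - by have [_ _ /eqP] := HP 0%N.
  - by have [_ _ _ ->] := HP n.
case: n => [|n]; first by exists 1; split; rewrite ?monic1 ?size_poly1 ?eqxx.
have [sW top /(_ (mulr1 1))] := Wcoef 1 n; rewrite !scale1r => sym.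
rewrite scale1r in sW top.
have [p Ep [sp]] := sym_at_x sW sym; rewrite top => /(monic_size sp)[mo szp].
by exists p; split=> // _; rewrite sum_psi_first.
Qed.

Lemma exists_second_kind : exists Q, is_second_kind Q.
Proof.
suff H n : exists p : {poly R[i]}, [/\ p \is monic, size p = n.+1 &
    (zvar - zvar^-1) * at_x p = - psi (2 * n.+1)
      + (1 - rcst (sieved_a (2 * n.+1 - 1))) * psi (2 * n.+1 - 1)].
  have [Q HQ] := boolp.choice H; exists Q; split=> [n|[//|n] _].
    by have [] := HQ n.
  by have [_ _ ->] := HQ n.
have ee : (-1) * (-1) = 1 :> R[i] by rewrite mulrNN mulr1.
have [sW top /(_ ee) sym] := Wcoef (-1) n.
have [p Ep [sp]] := skew_at_x sW sym.
rewrite top => /(_ isT) /(monic_size sp)[mo szp].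
by exists p; split=> //; rewrite sum_psi_second Ep scaleN1r.
Qed.

End SievedJacobi.

(* Main.v *)
From HB Require Import structures.
Require Import Defs.
From mathcomp Require Import ring lra zify.

Set Implicit Arguments.
Unset Strict Implicit.
Unset Printing Implicit Defensive.

Import Order.TTheory GRing.Theory Num.Theory.
Local Open Scope complex_scope.
Local Open Scope ring_scope.

(** Summing the reflection terms of [L] over the [N]-th roots of unity gives,
for [m, p >= 0],
  [L z^m = m z^m + sum_(0 <= j < 2m) c_j z^(m-j)],
  [L z^-p = - p z^-p - sum_(1 <= j <= 2p) c_j z^(j-p)],
where [c_j] vanishes unless [N] divides [j]. On the coefficients of a CMV
Laurent polynomial the eigenvalue equations
  [L psi_(2n) = - n psi_(2n)],
  [L psi_(2n-1) = (n + N (alpha + beta + 1)) psi_(2n-1)]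
become one linear system, which the Szego recurrence propagates from [Phi_k]
to [Phi_(k+1)]. Both eigenvalues are roots of
[x^2 - N (alpha + beta + 1) x = Lambda_n], so [H] acts on the span of
[psi_(2n)] and [psi_(2n-1)] as the scalar [Lambda_n]. *)

(** * Divisibility and parity of the distance |m - 2i| *)

Lemma dvdn_dist_double d m i : (i <= m)%N -> (d %| m - i)%N ->
  (d %| maxn m i.*2 - minn m i.*2)%N = (d %| m)%N.
Proof.
(* Up to sign, [m - 2i] equals [m - 2(m - i)] reversed, so it differs from [m] or [-m] by a multiple
   of [d]. *)
move=> im di; have d2 : (d %| (m - i).*2)%N by rewrite -muln2 dvdn_mulr.
case: (leqP m i.*2) => h.
  have -> : (i.*2 - m = m - (m - i).*2)%N by lia.
  rewrite dvdn_subl //; lia.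
have -> : (m - i.*2 = (m - i).*2 - m)%N by lia.
rewrite dvdn_subr //; lia.
Qed.

Lemma odd_dist_double m i : odd (maxn m i.*2 - minn m i.*2) = odd m.
Proof.
by case: (leqP m i.*2) => h; rewrite oddB ?(ltnW h) // odd_double ?addbF.
Qed.

(** * The linear system for the coefficients, and its stability under the Szego recurrence *)

Section Residuals.
Variables (R : realType) (alpha beta : R) (N : nat).
Hypothesis N_gt0 : (0 < N)%N.

(** These are the [c_j]. The factor [N] comes from summing over the roots of unity, and the parity
    of [j / N] selects which of the two parts of [A_k] survives. *)
Definition lcoef (j : nat) : R :=
  if (N %| j)%N then N%:R * (if odd (j %/ N) then alpha - beta
                             else alpha + beta + 1)
  else 0.

(** Off-diagonal matrix of [L] on Laurent monomials, up to sign. The two terms come from the two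
    expansions of [L], according to the sign of the exponent; comparing [l + i] with [K] says where
    each expansion stops. *)
Definition lweight (K i l : nat) : R :=
  (if (l < i)%N && (l + i < K)%N then lcoef (i - l) else 0)
  - (if (i < l)%N && (K <= l + i)%N then lcoef (l - i) else 0).

(* [residual K K f = 0] is the eigenvalue equation of [L] for the Laurent
   polynomial with coefficients [f 0, ..., f K.-1]. The threshold [K] is kept
   apart from the length [B] because the induction changes one at a time. *)
Definition residual (B K : nat) (f : nat -> R) (i : nat) : R :=
  (i%:R + (if (K <= i.*2)%N then lcoef 0 else 0)) * f i
  - \sum_(l < B) lweight K i l * f l.

Lemma residualB B K f g a i :
  residual B K (fun j => f j - a * g j) i
  = residual B K f i - a * residual B K g i.
Proof.
rewrite /residual; under eq_bigr do rewrite mulrBr mulrCA.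
by rewrite sumrB -mulr_sumr; ring.
Qed.

Lemma eq_residual B K f g i : (i < B)%N ->
  (forall j, (j < B)%N -> f j = g j) -> residual B K f i = residual B K g i.
Proof.
move=> iB E; rewrite /residual E //; congr (_ - _).
by apply: eq_bigr => l _; rewrite E.
Qed.

Lemma residual_widen B K f i : f B = 0 ->
  residual B.+1 K f i = residual B K f i.
Proof. by move=> f0; rewrite /residual big_ord_recr /= f0 mulr0 addr0. Qed.

(** Only the antidiagonal [l + i = K] is affected: there the first term appears or the second one
    disappears, and both changes add [c_|i-l|]. *)
Lemma lweightS K i l : (i <= K)%N -> 
  lweight K.+1 i l = lweight K i l
   + if (l == K - i)%N && (l != i) then lcoef (maxn i l - minn i l) else 0.
Proof.
move=> iK; rewrite /lweight; case: (ltngtP l i) => /= h;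
  last by rewrite andbF !subr0 addr0.
- rewrite !subr0 andbT ltnS leq_eqVlt.
  have -> : (l == K - i)%N = (l + i == K)%N by lia.
  by have [->|] := eqVneq (l + i)%N K; rewrite /= ?ltnn ?add0r ?addr0.
- rewrite !sub0r andbT.
  have -> : (l == K - i)%N = (l + i == K)%N by lia.
  have [<-|ne] := eqVneq (l + i)%N K; first by rewrite ltnn leqnn; ring.
  by rewrite addr0 ltn_neqAle eq_sym ne.
Qed.

Lemma residualS K f i : (i <= K)%N ->
  residual K.+1 K.+1 f i
  = residual K.+1 K f i - lcoef (maxn K i.*2 - minn K i.*2) * f (K - i)%N.
Proof.
move=> iK; rewrite /residual.
under eq_bigr => l _ do rewrite (lweightS _ iK) mulrDl.
rewrite big_split /=; set S := \sum_(l < _) lweight _ _ _ * _.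
have Ki : (K - i < K.+1)%N by lia.
rewrite (bigD1 (Ordinal Ki)) //= eqxx big1 ?addr0 /=; last first.
  move=> l ne; have -> : (l == K - i :> nat)%N = false.
    by apply: contraNF ne => /eqP E; apply/eqP/val_inj.
  by rewrite mul0r.
(* When [2i = K] the antidiagonal meets the diagonal, and the correction is the [c_0] that the
   diagonal entry loses. *)
have [e|ne] := eqVneq (K - i)%N i.
  have -> : (K < i.*2)%N = false by lia.
  have -> : (K <= i.*2)%N by lia.
  have -> : (maxn K i.*2 - minn K i.*2 = 0)%N by lia.
  by rewrite e /=; ring.
have -> : (K < i.*2)%N = (K <= i.*2)%N by lia.
have -> : (maxn i (K - i) - minn i (K - i) = maxn K i.*2 - minn K i.*2)%N by lia.
by rewrite /=; ring.
Qed.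

(** Reversing the indices exchanges the two triangles. A strict bound on [l + i] becomes a
    non-strict one, which accounts for the shift from [K.+1] to [K]. *)
Lemma lweight_rev K i l : (i <= K)%N -> (l <= K)%N ->
  lweight K.+1 i l = - lweight K (K - i) (K - l).
Proof.
move=> iK lK; rewrite /lweight opprB; congr (_ - _).
  have -> : (K - i < K - l)%N = (l < i)%N by lia.
  have -> : (K <= K - l + (K - i))%N = (l + i < K.+1)%N by lia.
  by congr (if _ then lcoef _ else _); lia.
have -> : (K - l < K - i)%N = (i < l)%N by lia.
have -> : (K - l + (K - i) < K)%N = (K.+1 <= l + i)%N by lia.
by congr (if _ then lcoef _ else _); lia.
Qed.

(** Exactly one of [K < 2i] and [K <= 2(K - i)] holds, so the two diagonal entries add up to
    [K + c_0]; the off-diagonal ones cancel by [lweight_rev]. *)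
Lemma residual_rev K f i : (i <= K)%N ->
  residual K.+1 K.+1 (fun j => f (K - j)%N) i
  = (K%:R + lcoef 0) * f (K - i)%N - residual K.+1 K f (K - i).
Proof.
move=> iK; rewrite /residual [X in _ - (_ - X)](reindex_inj rev_ord_inj) /=.
have E : \sum_(l < K.+1) lweight K.+1 i l * f (K - l)%N
  = - \sum_(l < K.+1) lweight K (K - i) (K.+1 - l.+1) * f (K.+1 - l.+1)%N.
  rewrite -sumrN; apply: eq_bigr => l _.
  by rewrite subSS lweight_rev -1?ltnS // mulNr.
rewrite E natrB //.
have -> : (K <= (K - i).*2)%N = ~~ (K < i.*2)%N by lia.
by case: (K < i.*2)%N => /=; ring.
Qed.

(* Coefficient of [z^(k-i)] in [Phi k]. *)
Fixpoint rcoef (k i : nat) : R :=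
  if k is m.+1 then
    if (i <= k)%N then
      rcoef m i - sieved_a alpha beta N m * rcoef m (k - i)
    else 0
  else (i == 0)%:R.

Lemma rcoef_oversize k i : (k < i)%N -> rcoef k i = 0.
Proof. by case: k => [|k]; [case: i | rewrite /= ltnNge => /negbTE ->]. Qed.

(** Sieving: the reversed term enters only when [N] divides [k + 1], and then [i] and [k + 1 - i]
    are multiples of [N] together. *)
Lemma rcoef_ndvd k i : ~~ (N %| i)%N -> rcoef k i = 0.
Proof.
elim: k i => [|k IH] i ndvd /=; first by case: i ndvd => //; rewrite dvdn0.
case: leqP => // ik; rewrite IH // sub0r /sieved_a.
case: ifP => [d|]; last by rewrite mul0r oppr0.
by rewrite IH ?mulr0 ?oppr0 // dvdn_subr.
Qed.

Hypothesis a_lt1 : forall n, `|jacobi_a alpha beta n| < 1.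

Lemma lcoef0 : lcoef 0 = N%:R * (alpha + beta + 1).
Proof. by rewrite /lcoef dvdn0 div0n. Qed.

(** Here the explicit Jacobi parameters enter. The numerator of [a_(M-1)] is minus [alpha - beta] or
    minus [alpha + beta + 1] according to the parity of [M], and its denominator
    [M + alpha + beta + 1] is positive. *)
Lemma jacobi_a_cancel M : (0 < M)%N ->
  N%:R * (if odd M then alpha - beta else alpha + beta + 1)
  + jacobi_a alpha beta M.-1 * (M%:R * N%:R + N%:R * (alpha + beta + 1)) = 0.
Proof.
case: M => // m _; have := jacobi_den_gt0 a_lt1 m.
rewrite /jacobi_a; set D := _ + 2 => /lt0r_neq0 D0.
have -> : m.+1%:R * N%:R + N%:R * (alpha + beta + 1) = N%:R * D.
  by rewrite /D -natr1; ring.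
rewrite mulrCA divfK // -mulrDr -signr_odd /=.
by case: (odd m); rewrite /= ?expr1 ?expr0; apply/eqP; rewrite mulf_eq0;
  apply/orP; right; apply/eqP; lra.
Qed.

(** Either the factor [rcoef] vanishes, or [N] divides [K + 1 - i]. In the latter case [N] divides
    [|K + 1 - 2i|] exactly when it divides [K + 1], and the two quotients have the same parity, so
    [jacobi_a_cancel] applies. *)
Lemma sieved_a_lcoef K i : (i <= K.+1)%N ->
  (lcoef (maxn K.+1 i.*2 - minn K.+1 i.*2)
    + sieved_a alpha beta N K * (K.+1%:R + lcoef 0)) * rcoef K (K.+1 - i) = 0.
Proof.
move=> iK; have [di|] := boolP (N %| K.+1 - i)%N; last first.
  by move=> nd; rewrite [rcoef _ _]rcoef_ndvd ?mulr0.
rewrite {1}/lcoef /sieved_a dvdn_dist_double //.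
case: ifP => dK; last by rewrite mul0r addr0 mul0r.
have /dvdnP[M eM] := dK.
have /dvdnP[I eI] : (N %| i)%N by rewrite -(dvdn_subr iK dK).
have M0 : (0 < M)%N by rewrite lt0n; apply/eqP => E; rewrite E in eM.
have -> : (maxn K.+1 i.*2 - minn K.+1 i.*2 = (maxn M I.*2 - minn M I.*2) * N)%N.
  by rewrite eM eI -!muln2 mulnAC muln2 -maxnMl -minnMl mulnBl.
rewrite mulnK // odd_dist_double eM mulnK // lcoef0 natrM.
by rewrite jacobi_a_cancel // mul0r.
Qed.

(** By induction, the direct term of the recurrence leaves [- c_|k+1-2i|] and the reversed one
    leaves [k + 1 + c_0], both times [rcoef k (k + 1 - i)]. Weighted by [a_k] they cancel by
    [sieved_a_lcoef]. *)
Lemma residual_rcoef k i : (i <= k)%N -> residual k.+1 k.+1 (rcoef k) i = 0.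
Proof.
elim: k i => [|k IH] i ik.
  move: ik; rewrite leqn0 => /eqP ->.
  by rewrite /residual big_ord1 /= /lweight !ltnn /=; ring.
have z0 : rcoef k k.+1 = 0 by rewrite rcoef_oversize.
(* The new last row holds trivially: its coefficient is zero and so are all its weights at threshold
   [k.+1]. *)
have {}IH j : (j <= k.+1)%N -> residual k.+2 k.+1 (rcoef k) j = 0.
  rewrite residual_widen // leq_eqVlt => /orP[/eqP ->|]; last exact: IH.
  rewrite /residual z0 mulr0 sub0r big1 ?oppr0 // => l _.
  have lk := ltn_ord l.
  rewrite /lweight; have -> : (l + k.+1 < k.+1)%N = false by lia.
  have -> : (k.+1 < l)%N = false by lia.
  by rewrite andbF /= subr0 mul0r.
rewrite (@eq_residual _ _ _ (fun j => rcoef k j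
    - sieved_a alpha beta N k * rcoef k (k.+1 - j))) //; last first.
  by move=> j jk; rewrite /= -ltnS jk.
rewrite residualB residualS // IH // sub0r residual_rev // IH ?leq_subr //.
rewrite subr0 mulrA -opprD -mulrDl.
by rewrite sieved_a_lcoef // oppr0.
Qed.

End Residuals.

(** * Roots of unity *)

Lemma sum_expr_unity (F : fieldType) (n : nat) (x : F) : x ^+ n = 1 ->
  \sum_(k < n) x ^+ k = if x == 1 then n%:R else 0.
Proof.
move=> xn; case: eqVneq => [->|x1].
  by under eq_bigr do rewrite expr1n; rewrite sumr_const card_ord.
have /eqP := subrX1 x n; rewrite xn subrr eq_sym mulf_eq0 subr_eq0 (negbTE x1).
by move/eqP.
Qed.

Lemma qrootX (R : realType) N k : qroot R N ^+ k =
  cos (2 * pi / N%:R * k%:R) +i* sin (2 * pi / N%:R * k%:R).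
Proof.
elim: k => [|k IH]; first by rewrite expr0 mulr0 cos0 sin0.
rewrite exprS IH /qroot; set t := 2 * pi / _.
have -> : t * k.+1%:R = t + t * k%:R by rewrite -natr1; ring.
by rewrite cosD sinD; apply/eqP; rewrite eq_complex /= eqxx addrC eqxx.
Qed.

Lemma qroot_prim (R : realType) N : (0 < N)%N -> N.-primitive_root (qroot R N).
Proof.
move=> N0; rewrite /primitive_root_of_unity N0; apply/forallP => i.
have n0 : N%:R != 0 :> R by rewrite pnatr_eq0 -lt0n.
rewrite unity_rootE qrootX; apply/eqP; case: (eqVneq i.+1 N) => [->|ne].
  by rewrite mulfVK // mulr_natl cos2pi sin2pi; exact: eqxx.
apply/negbTE; apply/negP; rewrite eq_complex /= => /andP[/eqP c1 _].
have lt : (i.+1 < N)%N by rewrite ltn_neqAle ne ltn_ord.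
(* Half the argument of the power of [qroot]: it lies strictly between 0 and pi, so
   [cos (2y) = 1 - 2 sin(y)^2] is less than 1. *)
pose y : R := pi / N%:R * i.+1%:R.
have sy : 0 < sin y.
  apply: sin_gt0_pi; rewrite /y mulr_gt0 ?divr_gt0 ?pi_gt0 ?ltr0n //=.
  by rewrite -mulrA gtr_pMr ?pi_gt0 // mulrC ltr_pdivrMr ?ltr0n // mul1r ltr_nat.
have E : 2 * pi / N%:R * i.+1%:R = y *+ 2 by rewrite /y; ring.
move: c1; rewrite E cos_mulr2n.
have := cos2Dsin2 y; have := exprn_gt0 2 sy; lra.
Qed.

(** * Cancellation of the poles of the reflection terms *)

(** The difference is [z^-m (x^m - z^(2m))], so [x - z^2] divides out and leaves a geometric sum.
    The pair [h], [b] serves both parities of [N]: later [x = q^k], [h = uphalf N] and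
    [b = odd N]. *)
Lemma dunkl_pos (F : fieldType) (x z s d : F) (h b m : nat) : (b <= 1)%N ->
  z != 0 -> x - z ^+ 2 != 0 ->
  (s * z ^+ 2 + x ^+ h * d * z ^+ (2 - b)) / (x - z ^+ 2)
    * ((x / z) ^+ m - z ^+ m)
  = \sum_(u < m) (s * x ^+ u * z ^ (m%:Z - (u.*2)%:Z)
                  + d * x ^+ (h + u) * z ^ (m%:Z - (u.*2 + b)%N%:Z)).
Proof.
move=> b1 z0 D0.
have -> : (x / z) ^+ m - z ^+ m =
  (x - z ^+ 2) * (z ^- m * \sum_(u < m) (z ^+ 2) ^+ (m.-1 - u) * x ^+ u).
  rewrite mulrCA -[x - _]opprB mulNr -subrXX expr_div_n -exprM mulrC.
  by rewrite mul2n -addnn exprD; field; rewrite expf_neq0.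
rewrite mulrA mulfVK // mulrA mulr_sumr; apply: eq_bigr => u _.
have um := ltn_ord u.
have e1 : z ^ (m%:Z - (u.*2)%:Z) = z ^+ 2 * z ^- m * (z ^+ 2) ^+ (m.-1 - u).
  rewrite -exprM -exprVn exprVn !exprnP exprnN -!expfzDr //; congr (_ ^ _); lia.
have e2 : z ^ (m%:Z - (u.*2 + b)%N%:Z)
    = z ^+ (2 - b) * z ^- m * (z ^+ 2) ^+ (m.-1 - u).
  rewrite -exprM !exprnP exprnN -!expfzDr //; congr (_ ^ _); lia.
by rewrite e1 e2 exprD; ring.
Qed.

(** The same factorisation with the opposite sign. Since [b <= 1], the subtraction in [t.+1.*2 - b]
    never truncates. *)
Lemma dunkl_neg (F : fieldType) (x z s d : F) (h b p : nat) : (b <= 1)%N ->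
  z != 0 -> x != 0 -> x - z ^+ 2 != 0 ->
  (s * z ^+ 2 + x ^+ h * d * z ^+ (2 - b)) / (x - z ^+ 2)
    * ((x / z) ^- p - z ^- p)
  = - \sum_(t < p) (s * x ^- t.+1 * z ^ ((t.+1.*2)%:Z - p%:Z)
                  + d * (x ^+ h * x ^- t.+1) * z ^ ((t.+1.*2 - b)%N%:Z - p%:Z)).
Proof.
move=> b1 z0 x0 D0.
have -> : (x / z) ^- p - z ^- p = - (x - z ^+ 2) *
  (z ^- p * x ^- p * \sum_(t < p) x ^+ (p.-1 - t) * (z ^+ 2) ^+ t).
  rewrite mulrCA mulNr -subrXX expr_div_n -exprM mul2n -addnn exprD.
  by field; rewrite !expf_neq0.
rewrite mulrA mulrN mulfVK // mulNr; congr (- _).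
rewrite mulrA mulr_sumr; apply: eq_bigr => t _.
have tp := ltn_ord t.
have e0 : x ^- t.+1 = x ^- p * x ^+ (p.-1 - t).
  rewrite !exprnP !exprnN -expfzDr //; congr (_ ^ _); lia.
have e1 : z ^ ((t.+1.*2)%:Z - p%:Z) = z ^+ 2 * z ^- p * (z ^+ 2) ^+ t.
  rewrite -exprM !exprnP exprnN -!expfzDr //; congr (_ ^ _); lia.
have e2 : z ^ ((t.+1.*2 - b)%N%:Z - p%:Z)
    = z ^+ (2 - b) * z ^- p * (z ^+ 2) ^+ t.
  rewrite -exprM !exprnP exprnN -!expfzDr //; congr (_ ^ _); lia.
by rewrite e0 e1 e2; ring.
Qed.

Lemma inv_monomial_deriv (F : fieldType) (w : F) n : w != 0 ->
  w * (- (n%:R * w ^+ n.-1) / (w ^+ n) ^+ 2) = - (n%:R * w ^- n).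
Proof.
move=> w0; case: n => [|n]; first by rewrite !mul0r oppr0 mul0r mulr0.
rewrite /= (exprS w n); have := expf_neq0 n w0; move: (w ^+ n) => y y0.
by field; rewrite w0 y0.
Qed.

(** * Linearity of substitution and derivation, and their values on powers of [z] *)

Section Operators.
Variable R : realType.
Local Notation K := (ratfun R).
Local Notation z := (@zvar R).

Lemma frac_ex (f : K) : exists n d : {poly R[i]}, d != 0 /\ f = n%:F / d%:F.
Proof.
by do 2 eexists; split; last exact: repr_frac; exact: denom_ratioP.
Qed.

Lemma peval_cst g c : @peval R g c%:P = cst c.
Proof. by rewrite /peval map_polyC hornerC. Qed.

Lemma pevalM g (p r : {poly R[i]}) : peval g (p * r) = peval g p * peval g r.
Proof. by rewrite /peval rmorphM hornerM. Qed.

Lemma pevalD g (p r : {poly R[i]}) : peval g (p + r) = peval g p + peval g r.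
Proof. by rewrite /peval rmorphD hornerD. Qed.

Lemma substfD c (f g : K) : c != 0 ->
  substf (cst c / z) (f + g) = substf (cst c / z) f + substf (cst c / z) g.
Proof.
move=> c0; have [n [d [d0 ->]]] := frac_ex f.
have [m [e [e0 ->]]] := frac_ex g.
rewrite addf_div ?tofrac_eq0 // -!tofracM -tofracD.
rewrite !subst_inv_frac ?mulf_neq0 // pevalD !pevalM.
by rewrite addf_div ?peval_inv_neq0.
Qed.

Lemma substfZ c a (f : K) : c != 0 ->
  substf (cst c / z) (cst a * f) = cst a * substf (cst c / z) f.
Proof.
move=> c0; have [n [d [d0 ->]]] := frac_ex f.
rewrite mulrA -tofracM !subst_inv_frac // pevalM peval_cst.
by rewrite mulrA.
Qed.

Lemma substf_zX c n : c != 0 -> substf (cst c / z) (z ^+ n) = (cst c / z) ^+ n.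
Proof.
move=> c0; have -> : z ^+ n = ('X^n)%:F / (1%:P)%:F.
  by rewrite tofracXn tofrac1 divr1.
rewrite subst_inv_frac ?oner_neq0 // peval_cst rmorph1 divr1.
by rewrite /peval map_polyXn hornerXn.
Qed.

Lemma substf_zXV c n : c != 0 ->
  substf (cst c / z) (z ^- n) = (cst c / z) ^- n.
Proof.
move=> c0; have -> : z ^- n = (1%:P)%:F / ('X^n)%:F.
  by rewrite tofracXn tofrac1 div1r.
rewrite subst_inv_frac ?expf_neq0 ?polyX_eq0 // peval_cst rmorph1 div1r.
by rewrite /peval map_polyXn hornerXn.
Qed.

Lemma ratderivD (f g : K) : ratderiv (f + g) = ratderiv f + ratderiv g.
Proof.
have [n [d [d0 ->]]] := frac_ex f.
have [m [e [e0 ->]]] := frac_ex g.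
rewrite addf_div ?tofrac_eq0 // -!tofracM -tofracD.
rewrite !ratderiv_frac ?mulf_neq0 // addf_div ?tofrac_eq0 ?expf_neq0 //.
rewrite -!tofracM -tofracD -exprMn; congr (tofrac _ / _).
by rewrite derivD !derivM; ring.
Qed.

Lemma ratderivZ a (f : K) : ratderiv (cst a * f) = cst a * ratderiv f.
Proof.
have [n [d [d0 ->]]] := frac_ex f.
rewrite mulrA -tofracM !ratderiv_frac // mulrA -tofracM; congr (tofrac _ / _).
by rewrite derivM derivC; ring.
Qed.

Lemma ratderiv_zX n : z * ratderiv (z ^+ n) = n%:R * z ^+ n.
Proof.
have -> : z ^+ n = ('X^n)%:F / 1%:F by rewrite tofracXn tofrac1 divr1.
rewrite ratderiv_frac ?oner_neq0 // expr1n tofrac1 !divr1 mulr1.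
rewrite -polyC1 derivC mulr0 subr0 derivXn -mulr_natl tofracM tofracXn.
rewrite rmorph_nat mulrCA; case: n => [|n]; first by rewrite !mul0r.
by rewrite exprS tofracM tofracXn.
Qed.

Lemma ratderiv_zXV n : z * ratderiv (z ^- n) = - (n%:R * z ^- n).
Proof.
have X0 : 'X^n != 0 :> {poly R[i]} by rewrite expf_neq0 ?polyX_eq0.
have -> : z ^- n = 1%:F / ('X^n)%:F by rewrite tofracXn tofrac1 div1r.
rewrite ratderiv_frac // -polyC1 derivC mul0r sub0r polyC1 mul1r tofracN.
rewrite !tofracXn tofrac1 derivXn -mulr_natl tofracM rmorph_nat tofracXn.
by rewrite div1r; exact/inv_monomial_deriv/zvar_neq0.
Qed.

End Operators.

HB.instance Definition _ (R : realType) :=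
  GRing.RMorphism.copy (@rcst R) (@cst R \o real_complex R).

Lemma sum_double (V : nmodType) (F : nat -> V) m :
  \sum_(j < m.*2) F j = \sum_(u < m) (F u.*2 + F u.*2.+1).
Proof.
elim: m => [|m IH]; first by rewrite !big_ord0.
by rewrite doubleS !big_ord_recr /= IH addrA.
Qed.

(** * Action of [L] on Laurent monomials *)

Section Monomials.
Variables (R : realType) (alpha beta : R) (N : nat).
Hypothesis N_gt0 : (0 < N)%N.
Local Notation K := (ratfun R).
Local Notation z := (@zvar R).
Local Notation c := (lcoef alpha beta N).
Local Notation L := (Lop alpha beta N).

(** This is the form produced by sums over roots of unity. For [N] even, [2u] is an odd multiple of
    [N] exactly when [N] divides [N/2 + u]; for [N] odd, only even multiples of [N] are even. *)
Lemma lcoef_double u : c u.*2 = N%:R * (((N %| u)%N)%:R * (alpha + beta + 1)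
  + (~~ odd N && (N %| uphalf N + u)%N)%:R * (alpha - beta)).
Proof.
rewrite /lcoef; have [oN|eN] /= := boolP (odd N).
  have cop : coprime N 2 by rewrite coprimen2.
  rewrite -muln2 Gauss_dvdl // mul0r addr0.
  case: ifP => [/dvdnP[t ->]|]; last by rewrite mul0r mulr0.
  by rewrite mulnAC mulnK // oddM andbF mul1r.
have [M eM] : exists M, N = M.*2 by exists N./2; lia.
have M0 : (0 < M)%N by lia.
have -> : uphalf N = M by lia.
rewrite eM -!muln2 dvdn_pmul2r //.
have [/dvdnP[t ->]|nd] := boolP (M %| u)%N.
  rewrite -mulSn ![(M * 2)%N]mulnC !dvdn_pmul2r // !dvdn2 /= negbK.
  rewrite [(2 * M)%N]mulnC divnMr // mulnK //.
  by case: (odd t); rewrite /= ?mul0r ?mul1r ?add0r ?addr0.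
have nd2 v : (M * 2 %| v)%N -> (M %| v)%N.
  by apply: dvdn_trans; rewrite dvdn_mulr.
have -> : (M * 2 %| u)%N = false by apply: contraNF nd => /nd2.
have -> : (M * 2 %| M + u)%N = false.
  by apply: contraNF nd => /nd2; rewrite dvdn_addr.
by rewrite !mul0r addr0 mulr0.
Qed.

(** An odd index can be a multiple of [N] only for [N] odd, and the quotient is then odd. Doubling
    [uphalf N + u] gives [N + 2u + 1]. *)
Lemma lcoef_doubleS u : c u.*2.+1 = N%:R *
  ((odd N && (N %| uphalf N + u)%N)%:R * (alpha - beta)).
Proof.
rewrite /lcoef; have [oN|eN] /= := boolP (odd N); last first.
  rewrite mul0r mulr0; case: ifP => // /dvdnP[t /(congr1 odd)].
  by rewrite oddM (negbTE eN) andbF /= odd_double.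
have cop : coprime N 2 by rewrite coprimen2.
have -> : (N %| u.*2.+1)%N = (N %| uphalf N + u)%N.
  rewrite -(Gauss_dvdl (uphalf N + u) cop) muln2.
  have -> : ((uphalf N + u).*2 = N + u.*2.+1)%N by lia.
  by rewrite dvdn_addr.
case: ifP => D; last by rewrite mul0r mulr0.
have [t et] : exists t, u.*2.+1 = (t * N)%N.
  have : (N %| N + u.*2.+1)%N.
    have -> : (N + u.*2.+1 = (uphalf N + u) * 2)%N by lia.
    exact: dvdn_mulr.
  by rewrite dvdn_addr // => /dvdnP.
rewrite et mulnK // mul1r; have := congr1 odd et.
by rewrite oddM oN andbT /= odd_double => <-.
Qed.

Lemma rcst_lcoef_double u : rcst (c u.*2) = N%:R * (((N %| u)%N)%:R
  * rcst (alpha + beta + 1)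
  + (~~ odd N && (N %| uphalf N + u)%N)%:R * rcst (alpha - beta)).
Proof. by rewrite lcoef_double rmorphM rmorphD !rmorphM !rmorph_nat. Qed.

Lemma rcst_lcoef_doubleS u : rcst (c u.*2.+1) = N%:R *
  ((odd N && (N %| uphalf N + u)%N)%:R * rcst (alpha - beta)).
Proof. by rewrite lcoef_doubleS !rmorphM !rmorph_nat. Qed.

Local Notation q := (cst (qroot R N) : K).

Lemma q_prim : N.-primitive_root q.
Proof. by rewrite fmorph_primitive_root qroot_prim. Qed.

Lemma q_neq0 : q != 0.
Proof.
apply/eqP => q0; have := prim_expr_order q_prim.
by rewrite q0 expr0n eqn0Ngt N_gt0 => /eqP; rewrite eq_sym oner_eq0.
Qed.

(** One formula for both parities: the power [q^(k * uphalf N)] is [(-1)^k] for [N] even, and it is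
    [rho k] for [N] odd because [uphalf N] then inverts 2 modulo [N]. *)
Lemma Acoef_exp k : (k < N)%N -> Acoef alpha beta N k =
  (rcst (alpha + beta + 1) * z ^+ 2
   + (q ^+ k) ^+ uphalf N * rcst (alpha - beta) * z ^+ (2 - odd N))
  / (q ^+ k - z ^+ 2).
Proof.
move=> kN; rewrite /Acoef rmorphXn /=; have qN := prim_expr_order q_prim.
have [oN|eN] := boolP (odd N).
  congr ((_ + _ * _ * _) / _).
  rewrite /rho -exprM; case: (boolP (odd k)) => ok; last first.
    rewrite rmorphXn /=.
    have -> : (k * uphalf N = k./2 * N + k./2)%N.
      have [ek eN] : k = k./2.*2 /\ N = N./2.*2.+1 by lia.
      have -> : uphalf N = N./2.+1 by lia.
      by rewrite {1}ek [in RHS]eN; nia.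
    by rewrite exprD mulnC exprM qN expr1n mul1r.
  rewrite fmorphV rmorphXn /=.
  have e : (k * uphalf N + (N - k)./2 = uphalf k * N)%N.
    have [ek eN] : k = k./2.*2.+1 /\ N = N./2.*2.+1 by lia.
    have [-> [-> ->]] : (N - k)./2 = (N./2 - k./2)%N /\
      uphalf N = N./2.+1 /\ uphalf k = k./2.+1 by lia.
    move: kN; rewrite {1}ek {1}eN [in RHS]eN {1}ek; nia.
  apply: (mulIf (expf_neq0 (N - k)./2 q_neq0)).
  by rewrite mulVf ?expf_neq0 ?q_neq0 // -exprD e mulnC exprM qN expr1n.
rewrite /sigma subn0 mulrA; congr (_ / _); rewrite -mulrDl; congr (_ * _).
have qh : q ^+ uphalf N = -1.
  have h2 : (q ^+ uphalf N) ^+ 2 = 1.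
    by rewrite -exprM; have -> : (uphalf N * 2 = N)%N by lia.
  have /eqP := h2; rewrite sqrf_eq1 => /orP[|/eqP //].
  by rewrite -(prim_order_dvd q_prim) gtnNdvd //; lia.
by rewrite -exprM mulnC exprM qh rmorphD rmorphM rmorphXn rmorphN1.
Qed.

Lemma sum_q u : \sum_(k < N) (q ^+ k) ^+ u = N%:R * ((N %| u)%N)%:R.
Proof.
under eq_bigr do rewrite exprAC.
rewrite sum_expr_unity; last by rewrite exprAC (prim_expr_order q_prim) expr1n.
by rewrite -(prim_order_dvd q_prim); case: ifP; rewrite ?mulr1 ?mulr0.
Qed.

Lemma sum_qV u v : \sum_(k < N) ((q ^+ k) ^+ u * (q ^+ k) ^- v) =
  N%:R * (u == v %[mod N])%:R.
Proof.
under eq_bigr => k _ do rewrite (exprAC _ k u) (exprAC _ k v) -expr_div_n.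
rewrite sum_expr_unity; last first.
  by rewrite expr_div_n !(exprAC _ _ N) (prim_expr_order q_prim) !expr1n divr1.
rewrite -(eq_prim_root_expr q_prim).
rewrite -(inj_eq (mulIf (expf_neq0 v q_neq0))) mulfVK ?expf_neq0 ?q_neq0 //.
by rewrite mul1r; case: ifP; rewrite ?mulr1 ?mulr0.
Qed.

Lemma den_neq0 k : q ^+ k - z ^+ 2 != 0.
Proof.
rewrite -rmorphXn /= /cst /= -tofracXn -tofracB tofrac_eq0 -oppr_eq0 opprB.
by rewrite -size_poly_eq0 size_XnsubC.
Qed.

Lemma Lop_zX m : L (z ^+ m) =
  m%:R * z ^+ m + \sum_(j < m.*2) rcst (c j) * z ^ (m%:Z - j%:Z).
Proof.
rewrite /Lop ratderiv_zX; congr (_ + _).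
transitivity (\sum_(k < N) \sum_(u < m)
  (rcst (alpha + beta + 1) * (q ^+ k) ^+ u * z ^ (m%:Z - (u.*2)%:Z)
   + rcst (alpha - beta) * (q ^+ k) ^+ (uphalf N + u)
     * z ^ (m%:Z - (u.*2 + odd N)%N%:Z))).
  apply: eq_bigr => k _; rewrite Acoef_exp // /Refl substf_zX; last first.
    by rewrite expf_neq0 // -cst_eq0 q_neq0.
  by rewrite rmorphXn dunkl_pos ?zvar_neq0 ?den_neq0 //; case: odd.
(* The indices [j = 2u] and [j = 2u + 1] are paired; the [alpha - beta] part falls on the former for
   [N] even and on the latter for [N] odd. *)
rewrite exchange_big (sum_double (fun j => rcst (c j) * z ^ (m%:Z - j%:Z))).
apply: eq_bigr => u _.
rewrite big_split /= -!mulr_suml -!mulr_sumr !sum_q.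
rewrite rcst_lcoef_double rcst_lcoef_doubleS.
by case: (odd N) => /=; rewrite ?addn1 ?addn0; ring.
Qed.

Lemma Lop_zXV p : L (z ^- p) =
  - (p%:R * z ^- p) - \sum_(j < p.*2) rcst (c j.+1) * z ^ (j.+1%:Z - p%:Z).
Proof.
rewrite /Lop ratderiv_zXV; congr (_ + _).
transitivity (- \sum_(k < N) \sum_(t < p)
  (rcst (alpha + beta + 1) * (q ^+ k) ^- t.+1 * z ^ ((t.+1.*2)%:Z - p%:Z)
   + rcst (alpha - beta) * ((q ^+ k) ^+ uphalf N * (q ^+ k) ^- t.+1)
     * z ^ ((t.+1.*2 - odd N)%N%:Z - p%:Z))).
  rewrite -sumrN; apply: eq_bigr => k _; rewrite Acoef_exp // /Refl.
  rewrite substf_zXV; last by rewrite expf_neq0 // -cst_eq0 q_neq0.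
  rewrite rmorphXn dunkl_neg ?zvar_neq0 ?den_neq0 ?expf_neq0 ?q_neq0 //.
  by case: odd.
congr (- _); rewrite exchange_big.
rewrite (sum_double (fun j => rcst (c j.+1) * z ^ (j.+1%:Z - p%:Z))).
apply: eq_bigr => t _.
have E : \sum_(k < N) (q ^+ k) ^- t.+1 = N%:R * (N %| t.+1)%:R.
  under eq_bigr => k _ do rewrite -[_^-1]mul1r -[X in X / _](expr0 (q ^+ k)).
  by rewrite sum_qV [_ == _ %[mod N]]eq_sym mod0n.
rewrite big_split /= -!mulr_suml -!mulr_sumr E sum_qV.
rewrite -doubleS rcst_lcoef_double rcst_lcoef_doubleS.
(* Both sides are shifted by [uphalf N - odd N], using [2 * uphalf N - odd N = N]. *)
have H : (uphalf N == t.+1 %[mod N]) = (N %| uphalf N + (t.+1 - odd N))%N.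
  rewrite -(eqn_modDr (uphalf N - odd N)).
  have -> : (uphalf N + (uphalf N - odd N) = N)%N by lia.
  have -> : (t.+1 + (uphalf N - odd N) = uphalf N + (t.+1 - odd N))%N by lia.
  by rewrite modnn eq_sym.
rewrite H.
case: (odd N) => /=; rewrite ?doubleS ?subn1 ?subn0 /=; ring.
Qed.

End Monomials.

(** * Reindexing of sums, and real constants *)

(** An explicit inverse [g] reduces the side conditions to linear arithmetic. *)
Lemma sum_reindex_nat (V : nmodType) (h g : nat -> nat) M B (P : pred nat)
    (F : nat -> V) :
  (forall j, (j < M)%N -> [/\ (h j < B)%N, P (h j) & g (h j) = j]) ->
  (forall i, (i < B)%N -> P i -> (g i < M)%N /\ h (g i) = i) ->
  \sum_(i < B | P i) F i = \sum_(j < M) F (h j).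
Proof.
move=> hP gP; rewrite -(big_mkord P F) -(big_mkord xpredT (F \o h)) /index_iota.
rewrite -big_filter -[RHS](big_map h xpredT F) !subn0; apply: perm_big.
have injh : {in iota 0 M &, injective h}.
  move=> i j; rewrite !mem_iota !add0n /= => iM jM E.
  by have [_ _ <-] := hP i iM; have [_ _ <-] := hP j jM; rewrite E.
apply: uniq_perm; rewrite ?filter_uniq ?map_inj_in_uniq ?iota_uniq // => i.
rewrite mem_filter mem_iota add0n /=; apply/andP/mapP => [[Pi iB]|[j]].
  by have [gM E] := gP i iB Pi; exists (g i) => //; rewrite mem_iota.
by rewrite mem_iota add0n /= => /hP[? ? _] ->.
Qed.

Lemma rcst1 (R : realType) : rcst (1 : R) = 1.
Proof. exact: (rmorph1 (@rcst R)). Qed.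

Lemma rcst1D (R : realType) (a : R) : rcst (1 + a) = 1 + rcst a.
Proof. by rewrite (rmorphD (@rcst R)) /= rcst1. Qed.

Lemma rcst_comb_first (R : realType) (x y : ratfun R) (a : R) :
  x + (1 + rcst a) * y = rcst 1 * x + rcst (1 + a) * y.
Proof. by rewrite rcst1D rcst1 [X in _ = X + _]mul1r. Qed.

Lemma rcst_comb_second (R : realType) (x y : ratfun R) (a : R) :
  - x + (1 - rcst a) * y = rcst (-1) * x + rcst (1 - a) * y.
Proof.
by rewrite rcst1D !(rmorphN (@rcst R)) /= rcst1 [X in _ = X + _]mulN1r.
Qed.

(** * Matrix of [L] and the eigenvalue equations for [psi] *)

Section Eigenfunctions.
Variables (R : realType) (alpha beta : R) (N : nat).
Hypothesis N_gt0 : (0 < N)%N.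
Local Notation K := (ratfun R).
Local Notation z := (@zvar R).
Local Notation c := (lcoef alpha beta N).
Local Notation w := (lweight alpha beta N).
Local Notation L := (Lop alpha beta N).

Lemma qrootX_neq0 k : qroot R N ^+ k != 0.
Proof. by rewrite expf_neq0 // -cst_eq0 q_neq0. Qed.

Lemma LopD (f g : K) : L (f + g) = L f + L g.
Proof.
rewrite /Lop ratderivD mulrDr addrACA -big_split /=; congr (_ + _).
apply: eq_bigr => k _; rewrite -mulrDr /Refl substfD ?qrootX_neq0 //.
by congr (_ * _); ring.
Qed.

Lemma LopZ a (f : K) : L (rcst a * f) = rcst a * L f.
Proof.
rewrite /Lop ratderivZ mulrCA mulrDr mulr_sumr; congr (_ + _).
apply: eq_bigr => k _; rewrite /Refl substfZ ?qrootX_neq0 // -mulrBr.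
by rewrite mulrCA.
Qed.

Lemma Lop_sum B (a : nat -> R) (F : nat -> K) :
  L (\sum_(l < B) rcst (a l) * F l) = \sum_(l < B) rcst (a l) * L (F l).
Proof.
elim: B => [|B IH]; last by rewrite !big_ord_recr /= LopD IH LopZ.
by rewrite !big_ord0 -[X in L X](mul0r (1 : K)) -(rmorph0 (@rcst R)) LopZ
  rmorph0 mul0r.
Qed.

(** The term [j = 0] is diagonal and is split off; for [m = 0] the sum is empty and [c_0] does not
    occur. *)
Lemma Lop_zpos m : (0 < m)%N -> L (z ^ m%:Z) = rcst (m%:R + c 0) * z ^ m%:Z
  + \sum_(j < m.*2.-1) rcst (c j.+1) * z ^ (m%:Z - j.+1%:Z).
Proof.
case: m => // m _; rewrite -exprnP Lop_zX // doubleS big_ord_recl /= subr0.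
by rewrite -exprnP rmorphD rmorph_nat mulrDl addrA.
Qed.

Lemma Lop_znpos p : L (z ^ (- p%:Z)) = - rcst p%:R * z ^ (- p%:Z)
  - \sum_(j < p.*2) rcst (c j.+1) * z ^ (j.+1%:Z - p%:Z).
Proof. by rewrite -exprnN Lop_zXV // rmorph_nat mulNr. Qed.

Lemma lweight_low B i l : (l.*2 < B)%N ->
  w B i l = if (l < i)%N && (l + i < B)%N then c (i - l) else 0.
Proof.
move=> lB; rewrite /lweight; have -> : (i < l)%N && (B <= l + i)%N = false by lia.
by rewrite subr0.
Qed.

Lemma lweight_high B i l : (B <= l.*2)%N ->
  w B i l = - if (i < l)%N && (B <= l + i)%N then c (l - i) else 0.
Proof.
move=> lB; rewrite /lweight; have -> : (l < i)%N && (l + i < B)%N = false by lia.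
by rewrite sub0r.
Qed.

Lemma sum_rcst_if B (P : pred nat) (a : nat -> R) (F : nat -> K) :
  \sum_(i < B) rcst (if P i then a i else 0) * F i
  = \sum_(i < B | P i) rcst (a i) * F i.
Proof.
rewrite [RHS]big_mkcond; apply: eq_bigr => i _.
by case: ifP => // _; rewrite rmorph0 mul0r.
Qed.

Lemma Lop_z_odd n l : (l < n.*2.+1)%N ->
  L (z ^ (l%:Z - n%:Z)) =
  rcst (l%:R - n%:R + if (n.*2.+1 <= l.*2)%N then c 0 else 0)
    * z ^ (l%:Z - n%:Z)
  - \sum_(i < n.*2.+1) rcst (w n.*2.+1 i l) * z ^ (i%:Z - n%:Z).
Proof.
move=> lB; have [ln|nl] := leqP l n.
  have -> : l%:Z - n%:Z = - (n - l)%N%:Z by lia.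
  rewrite Lop_znpos; have -> : (n.*2 < l.*2)%N = false by lia.
  rewrite addr0 natrB // -rmorphN opprB; congr (_ - _).
  under [RHS]eq_bigr do rewrite lweight_low ?ltnS ?leq_double //.
  rewrite (sum_rcst_if _ (fun i => (l < i) && (l + i < n.*2.+1))%N
    (fun i => c (i - l)) (fun i => z ^ (i%:Z - n%:Z))).
  rewrite (@sum_reindex_nat _ (fun j => l + j.+1)%N (fun i => i - l.+1)%N
    (n - l).*2 _ (fun i => (l < i) && (l + i < n.*2.+1))%N
    (fun i => rcst (c (i - l)) * z ^ (i%:Z - n%:Z))); last 2 first.
  - by move=> j jM; split; lia.
  - by move=> i iM iP; split; lia.
  apply: eq_bigr => j _; congr (rcst (c _) * z ^ _); lia.
have -> : l%:Z - n%:Z = (l - n)%N%:Z by lia.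
rewrite Lop_zpos ?subn_gt0 //; have -> : (n.*2 < l.*2)%N by lia.
rewrite natrB 1?ltnW //; congr (_ + _).
under [X in - X]eq_bigr do rewrite lweight_high ?ltn_double // rmorphN mulNr.
rewrite sumrN opprK.
rewrite (sum_rcst_if _ (fun i => (i < l) && (n.*2.+1 <= l + i))%N
  (fun i => c (l - i)) (fun i => z ^ (i%:Z - n%:Z))).
rewrite (@sum_reindex_nat _ (fun j => l - j.+1)%N (fun i => l - i.+1)%N
  (l - n).*2.-1 _ (fun i => (i < l) && (n.*2.+1 <= l + i))%N
  (fun i => rcst (c (l - i)) * z ^ (i%:Z - n%:Z))); last 2 first.
- by move=> j jM; split; lia.
- by move=> i iM iP; split; lia.
apply: eq_bigr => j _; have := ltn_ord j => jM.
congr (rcst (c _) * z ^ _); lia.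
Qed.

(** The exponents [n - i] descend here, whereas they ascend in [Lop_z_odd]. This flips the sign of
    the weights, so that both cases lead to the same [residual]. *)
Lemma Lop_z_even n l : (l < n.*2)%N ->
  L (z ^ (n%:Z - l%:Z)) =
  rcst (n%:R - l%:R + if (n.*2 <= l.*2)%N then 0 else c 0)
    * z ^ (n%:Z - l%:Z)
  + \sum_(i < n.*2) rcst (w n.*2 i l) * z ^ (n%:Z - i%:Z).
Proof.
move=> lB; have [nl|ln] := leqP n l.
  have -> : n%:Z - l%:Z = - (l - n)%N%:Z by lia.
  rewrite Lop_znpos; have -> : (n.*2 <= l.*2)%N by lia.
  rewrite addr0 natrB // -rmorphN opprB; congr (_ + _).
  under [RHS]eq_bigr do rewrite lweight_high ?leq_double // rmorphN mulNr.
  rewrite sumrN; congr (- _).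
  rewrite (sum_rcst_if _ (fun i => (i < l) && (n.*2 <= l + i))%N
    (fun i => c (l - i)) (fun i => z ^ (n%:Z - i%:Z))).
  rewrite (@sum_reindex_nat _ (fun j => l - j.+1)%N (fun i => l - i.+1)%N
    (l - n).*2 _ (fun i => (i < l) && (n.*2 <= l + i))%N
    (fun i => rcst (c (l - i)) * z ^ (n%:Z - i%:Z))); last 2 first.
  - by move=> j jM; split; lia.
  - by move=> i iM iP; split; lia.
  apply: eq_bigr => j _; have := ltn_ord j => jM.
  congr (rcst (c _) * z ^ _); lia.
have -> : n%:Z - l%:Z = (n - l)%N%:Z by lia.
rewrite Lop_zpos ?subn_gt0 //; have -> : (n.*2 <= l.*2)%N = false by lia.
rewrite natrB 1?ltnW //; congr (_ + _).
under [RHS]eq_bigr do rewrite lweight_low ?ltn_double //.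
rewrite (sum_rcst_if _ (fun i => (l < i) && (l + i < n.*2))%N
  (fun i => c (i - l)) (fun i => z ^ (n%:Z - i%:Z))).
rewrite (@sum_reindex_nat _ (fun j => l + j.+1)%N (fun i => i - l.+1)%N
  (n - l).*2.-1 _ (fun i => (l < i) && (l + i < n.*2))%N
  (fun i => rcst (c (i - l)) * z ^ (n%:Z - i%:Z))); last 2 first.
- by move=> j jM; split; lia.
- by move=> i iM iP; split; lia.
apply: eq_bigr => j _; congr (rcst (c _) * z ^ _); lia.
Qed.

Lemma sum_lweight B (f : nat -> R) (F : nat -> K) :
  \sum_(l < B) rcst (f l) * (\sum_(i < B) rcst (w B i l) * F i)
  = \sum_(i < B) rcst (\sum_(l < B) w B i l * f l) * F i.
Proof.
under eq_bigr do rewrite mulr_sumr.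
rewrite exchange_big; apply: eq_bigr => i _ /=.
rewrite rmorph_sum mulr_suml; apply: eq_bigr => l _.
by rewrite rmorphM mulrCA mulrA.
Qed.

(** In this basis [L] is the residual matrix minus [n]. *)
Lemma Lop_residual_odd n (f : nat -> R) :
  (forall i, (i < n.*2.+1)%N ->
     residual alpha beta N n.*2.+1 n.*2.+1 f i = 0) ->
  let F := \sum_(i < n.*2.+1) rcst (f i) * z ^ (i%:Z - n%:Z) in
  L F = rcst (- n%:R) * F.
Proof.
move=> H; rewrite /= (Lop_sum _ f (fun i => z ^ (i%:Z - n%:Z))) /=.
under eq_bigr => l _ do rewrite Lop_z_odd // mulrBr.
rewrite sumrB (sum_lweight _ f (fun i => z ^ (i%:Z - n%:Z))) -sumrB mulr_sumr.
apply: eq_bigr => i _; rewrite !mulrA -mulrBl -!rmorphM -rmorphB.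
congr (rcst _ * _).
have := H i (ltn_ord i); rewrite /residual => /eqP; rewrite subr_eq0 => /eqP <-.
by ring.
Qed.

(** In this basis [L] is [n + c_0] minus the residual matrix. *)
Lemma Lop_residual_even n (f : nat -> R) :
  (forall i, (i < n.*2)%N -> residual alpha beta N n.*2 n.*2 f i = 0) ->
  let F := \sum_(i < n.*2) rcst (f i) * z ^ (n%:Z - i%:Z) in
  L F = rcst (n%:R + N%:R * (alpha + beta + 1)) * F.
Proof.
move=> H; rewrite /= (Lop_sum _ f (fun i => z ^ (n%:Z - i%:Z))) /=.
under eq_bigr => l _ do rewrite Lop_z_even // mulrDr.
rewrite big_split (sum_lweight _ f (fun i => z ^ (n%:Z - i%:Z))) -big_split.
rewrite mulr_sumr.
apply: eq_bigr => i _ /=; rewrite !mulrA -mulrDl -!rmorphM -rmorphD.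
congr (rcst _ * _).
have := H i (ltn_ord i); rewrite /residual => /eqP; rewrite subr_eq0 => /eqP <-.
by rewrite -lcoef0; case: ifP => _; ring.
Qed.

Local Notation a := (sieved_a alpha beta N).
Local Notation r := (rcoef alpha beta N).

Lemma substf_invz_sum B (f : nat -> R) (e : nat -> nat) :
  substf z^-1 (\sum_(i < B) rcst (f i) * z ^+ e i)
  = \sum_(i < B) rcst (f i) * z ^- e i.
Proof.
have -> : z^-1 = cst 1 / z by rewrite rmorph1 mul1r.
elim: B => [|B IH].
  rewrite !big_ord0 -[X in substf _ X](mul0r (1 : K)) -(rmorph0 (@cst R)).
  by rewrite substfZ ?oner_neq0 // rmorph0 mul0r.
rewrite !big_ord_recr /= substfD ?oner_neq0 // IH; congr (_ + _).
rewrite substfZ ?oner_neq0 //; congr (_ * _).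
by rewrite substf_zX ?oner_neq0 // (rmorph1 (@cst R)) mul1r exprVn.
Qed.

Lemma Phi_rcoef k :
  Phi alpha beta N k = \sum_(i < k.+1) rcst (r k i) * z ^+ (k - i).
Proof.
elim: k => [|k IH]; first by rewrite big_ord1 /= rmorph1 mul1r.
have -> : Phi alpha beta N k.+1 = z * Phi alpha beta N k
  - rcst (a k) * (z ^+ k * substf z^-1 (Phi alpha beta N k)) by [].
rewrite IH (substf_invz_sum _ (r k) (fun i => k - i)%N).
have z0 : r k k.+1 = 0 by rewrite rcoef_oversize.
(* Since [r k k.+1 = 0], both terms of the recurrence can be padded to the same range. *)
transitivity (\sum_(i < k.+2) rcst (r k i) * z ^+ (k.+1 - i)
  - rcst (a k) * \sum_(i < k.+2) rcst (r k (k.+1 - i)) * z ^+ (k.+1 - i)).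
  congr (_ - _ * _).
    rewrite [RHS]big_ord_recr /= z0 rmorph0 mul0r addr0 mulr_sumr.
    by apply: eq_bigr => i _; rewrite mulrCA -exprS subSn // -ltnS.
  rewrite [RHS](reindex_inj rev_ord_inj) [RHS]big_ord_recr /= subnn subn0 z0.
  rewrite rmorph0 mul0r addr0 mulr_sumr; apply: eq_bigr => i _ /=.
  have ik : (i <= k)%N by rewrite -ltnS.
  rewrite subSS subKn 1?leqW // mulrCA; congr (_ * _).
  by rewrite !exprnP exprnN -expfzDr ?zvar_neq0 //; congr (_ ^ _); lia.
rewrite mulr_sumr -sumrB; apply: eq_bigr => i _.
have ik : (i <= k.+1)%N by rewrite -ltnS.
by rewrite /= ik rmorphB rmorphM mulrBl mulrA.
Qed.

Hypothesis a_lt1 : forall n, `|jacobi_a alpha beta n| < 1.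

Lemma Lop_psi_even n :
  L (psi alpha beta N n.*2) = rcst (- n%:R) * psi alpha beta N n.*2.
Proof.
rewrite /psi odd_double doubleK Phi_rcoef.
rewrite (substf_invz_sum _ (r n.*2) (fun i => n.*2 - i)%N) mulr_sumr.
rewrite (eq_bigr (fun i : 'I_ _ => rcst (r n.*2 i) * z ^ (i%:Z - n%:Z))).
  by apply: Lop_residual_odd => i iB; exact: residual_rcoef.
move=> i _; have iB := ltn_ord i; rewrite mulrCA; congr (_ * _).
by rewrite exprnP exprnN -expfzDr ?zvar_neq0 //; congr (_ ^ _); lia.
Qed.

Lemma Lop_psi_odd n : L (psi alpha beta N n.*2.+1) =
  rcst (n.+1%:R + N%:R * (alpha + beta + 1)) * psi alpha beta N n.*2.+1.
Proof.
have h2 : (n.*2.+1./2 = n)%N by lia.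
rewrite /psi oddS odd_double h2 Phi_rcoef mulr_sumr.
rewrite (eq_bigr (fun i : 'I_ _ => rcst (r n.*2.+1 i) * z ^ (n.+1%:Z - i%:Z))).
  by apply: (@Lop_residual_even n.+1) => i iB; exact: residual_rcoef.
move=> i _; have iB := ltn_ord i; rewrite mulrCA; congr (_ * _).
by rewrite exprnN exprnP -expfzDr ?zvar_neq0 //; congr (_ ^ _); lia.
Qed.

(** * The operator [H] on the span of two consecutive [psi] *)

Local Notation H := (Hop alpha beta N).
Local Notation lam n := (rcst (Lambda alpha beta N n)).

Lemma HopD (f g : K) : H (f + g) = H f + H g.
Proof. by rewrite /Hop !LopD; ring. Qed.

Lemma HopZ b (f : K) : H (rcst b * f) = rcst b * H f.
Proof. by rewrite /Hop !LopZ; ring. Qed.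

Lemma Hop_eigen (e : R) (f : K) : L f = rcst e * f ->
  H f = rcst (e * (e - N%:R * (alpha + beta + 1))) * f.
Proof. by move=> E; rewrite /Hop E LopZ E (rmorphM _ e) (rmorphB _ e); ring. Qed.

Lemma Hop_psi_even n :
  H (psi alpha beta N n.*2) = lam n * psi alpha beta N n.*2.
Proof.
rewrite (Hop_eigen (Lop_psi_even n)); congr (rcst _ * _).
by rewrite /Lambda; ring.
Qed.

Lemma Hop_psi_odd n :
  H (psi alpha beta N n.*2.+1) = lam n.+1 * psi alpha beta N n.*2.+1.
Proof.
rewrite (Hop_eigen (Lop_psi_odd n)); congr (rcst _ * _).
by rewrite /Lambda; ring.
Qed.

Lemma Hop_psi_comb n b d (F : K) :
  F = rcst b * psi alpha beta N (2 * n.+1)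
    + rcst d * psi alpha beta N (2 * n.+1 - 1) ->
  H F = lam n.+1 * F.
Proof.
have -> : (2 * n.+1 - 1 = n.*2.+1)%N by lia.
rewrite mul2n => ->; rewrite HopD !HopZ Hop_psi_even Hop_psi_odd.
by rewrite [RHS]mulrDr (mulrCA (rcst b)) (mulrCA (rcst d)).
Qed.

End Eigenfunctions.

Theorem theorem6p1 (R : realType) (N : nat) (alpha beta : R) :
  (1 <= N)%N ->
  (forall n : nat, `|jacobi_a alpha beta n| < 1) ->
  forall P Q : nat -> {poly R[i]},
  is_first_kind alpha beta N P ->
  is_second_kind alpha beta N Q ->
  forall n : nat,
    Hop alpha beta N (at_x (P n)) =
      rcst (Lambda alpha beta N n) * at_x (P n)
    /\
    Htilde alpha beta N (at_x (Q n)) =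
      rcst (Lambda alpha beta N n.+1) * at_x (Q n).
Proof.
move=> N0 a_lt1 P Q [_ P0 HP] [_ HQ] n; split.
  case: n => [|n].
    (* The relation with [psi] starts at [n = 1]; for [n = 0] the constant 1 is [psi_0]. *)
    have -> : at_x (P 0%N) = psi alpha beta N 0.*2.
      rewrite P0 /at_x /psi /= expr0 mul1r -tofrac1 subst_invz.
      by rewrite /peval !rmorph1 !hornerC.
    exact: Hop_psi_even.
  apply: (Hop_psi_comb N0 a_lt1 (b := 1)
            (d := 1 + sieved_a alpha beta N (2 * n.+1 - 1))).
  exact: etrans (HP n.+1 isT) (rcst_comb_first _ _ _).
(* Multiplied by [phi], [Q_n] lies in the span for index [n + 1], whence the shifted eigenvalue. *)
have E : (zvar - zvar^-1) * at_x (Q n)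
    = rcst (-1) * psi alpha beta N (2 * n.+1)
      + rcst (1 - sieved_a alpha beta N (2 * n.+1 - 1))
        * psi alpha beta N (2 * n.+1 - 1).
  exact: etrans (HQ n.+1 isT) (rcst_comb_second _ _ _).
rewrite /Htilde (Hop_psi_comb N0 a_lt1 E) mulrCA mulKf //.
(* [z * phi] is the nonzero polynomial [z^2 - 1], so [phi] is invertible. *)
suff : zvar * (zvar - zvar^-1) != 0 :> ratfun R.
  by rewrite mulf_eq0 negb_or => /andP[].
by rewrite -zX22 tofrac_eq0 -size_poly_eq0 size_XnsubC.
Qed.
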